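(* Let $G$ be an operator system and $\Omega=(\Omega_n)_{n\ge1}$ an open fully matricial $G$-set. If $r=(r_n)_{n\ge1}\in A(\Omega)$, then $(\partial_{m,n}r_{m+n})_{m\ge1,n\ge1}\in A(\Omega;\Omega)$.
   Context: $\mathfrak{M}_n$ denotes the $n\times n$ complex matrices; $\mathfrak{M}_n(G)=\mathfrak{M}_n\otimes G$. $G$ is an operator system (a unital selfadjoint space of Hilbert space operators, with unit $1$). For $S\in GL(n;\mathbb{C})$, $(\mathrm{Ad}S)(T)=STS^{-1}$, and $(\mathrm{Ad}S\otimes I_G)(T\otimes g)=STS^{-1}\otimes g$; $a\oplus b$ is the block diagonal matrix. A fully matricial $G$-set is a sequence $\Omega=(\Omega_n)_{n\ge1}$ with $\Omega_n\subset\mathfrak{M}_n(G)$, $\Omega_{m+n}\cap(\mathfrak{M}_m(G)\oplus\mathfrak{M}_n(G))=\Omega_m\oplus\Omega_n$, and $(\mathrm{Ad}S\otimes I_G)(\Omega_n)=\Omega_n$ for all $S\in GL(n;\mathbb{C})$. It is open if each $\Omega_n$ is open. $A(\Omega)$ is the set of scalar fully matricial analytic functions on $\Omega$: sequences $r=(r_n)_{n\ge1}$ of analytic functions $r_n:\Omega_n\to\mathfrak{M}_n$ with $r_{m+n}(g'\oplus g'')=r_m(g')\oplus r_n(g'')$ for $g'\in\Omega_m,g''\in\Omega_n$, and $r_n((\mathrm{Ad}S\otimes I_G)(g))=(\mathrm{Ad}S)(r_n(g))$ for $S\in GL(n;\mathbb{C})$, $g\in\Omega_n$. $A(\Omega;\Omega)$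 is the set of two-variable scalar fully matricial analytic functions on $\Omega\times\Omega$: families $(f_{m,n})_{m\ge1,n\ge1}$ of analytic maps $f_{m,n}:\Omega_m\times\Omega_n\to\mathfrak{M}_m\otimes\mathfrak{M}_n$ such that (a) $f_{m,n}((\mathrm{Ad}S_1\otimes I_G)(g_1),(\mathrm{Ad}S_2\otimes I_G)(g_2))=((\mathrm{Ad}S_1)\otimes(\mathrm{Ad}S_2))f_{m,n}(g_1,g_2)$ for $S_1\in GL(m;\mathbb{C})$, $S_2\in GL(n;\mathbb{C})$; (b) $f_{m_1+m_2,n}(g'\oplus g'',g)=f_{m_1,n}(g',g)\oplus f_{m_2,n}(g'',g)$, the direct sum being in $(\mathfrak{M}_{m_1}\otimes\mathfrak{M}_n)\oplus(\mathfrak{M}_{m_2}\otimes\mathfrak{M}_n)=(\mathfrak{M}_{m_1}\oplus\mathfrak{M}_{m_2})\otimes\mathfrak{M}_n\subset\mathfrak{M}_{m_1+m_2}\otimes\mathfrak{M}_n$; (c) $f_{m,n_1+n_2}(g,g'\oplus g'')=f_{m,n_1}(g,g')\oplus f_{m,n_2}(g,g'')$, the direct sum being in $(\mathfrak{M}_m\otimes\mathfrak{M}_{n_1})\oplus(\mathfrak{M}_m\otimes\mathfrak{M}_{n_2})=\mathfrak{M}_m\otimes(\mathfrak{M}_{n_1}\oplus\mathfrak{M}_{n_2})\subset\mathfrak{M}_m\otimes\mathfrak{M}_{n_1+n_2}$. For an analytic $GL(m+n;\mathbb{C})$-equivariant map $f:\Omega_{m+n}\to\mathfrak{M}_{m+n}$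 and $g'\in\Omega_m$, $g''\in\Omega_n$, $$(\partial_{m,n}f)(g',g'')=\sum_{1\le i,j\le m}\ \sum_{1\le k,l\le n}\Bigl(\tfrac{d}{d\varepsilon}f(g'\oplus g''+\varepsilon e_{j,k+m}\otimes1)\big|_{\varepsilon=0}\Bigr)_{i,m+l}\,e^{(m)}_{ij}\otimes e^{(n)}_{kl}\in\mathfrak{M}_m\otimes\mathfrak{M}_n,$$ where $(\cdot)_{i,m+l}$ is the $(i,m+l)$ entry, $e_{j,k+m}$ is a matrix unit in $\mathfrak{M}_{m+n}$, and $e^{(m)}_{ij},e^{(n)}_{kl}$ are the matrix units of $\mathfrak{M}_m,\mathfrak{M}_n$. *)

(* Defs.v *)
From HB Require Import structures.
From mathcomp Require Import all_boot all_order all_algebra.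
From mathcomp Require Import sesquilinear complex mxtens.
From mathcomp Require Import boolp classical_sets functions reals.
From mathcomp Require Import topology normedtype sequences derive.

Set Implicit Arguments.
Unset Strict Implicit.
Unset Printing Implicit Defensive.

Import Order.TTheory GRing.Theory Num.Theory.
Import numFieldNormedType.Exports.
Local Open Scope classical_set_scope.
Local Open Scope ring_scope.
Local Open Scope complex_scope.

Notation "A *t B" := (tensmx A B)
  (at level 40, left associativity, format "A  *t  B") : ring_scope.

(* Norms in a normed module over R[i] take their values in R[i]; nrm is the
   same norm with values in R. *)
Definition nrm (R : realType) (W : normedModType R[i]) (w : W) : R :=
  complex.Re `|w|.

(* H is a complex Hilbert space: it is complete by its type, and its norm is
   the one given by the inner product dot (linear in its first argument). *)
Definition hilbert_dot (R : realType) (H : completeNormedModType R[i])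
    (dot : {dot H for (@Num.conj R[i])}) : Prop :=
  forall x : H, `|x| ^+ 2 = dot x x.

Definition operator_system (R : realType) (H : completeNormedModType R[i])
    (dot : {dot H for (@Num.conj R[i])}) (G : set (H -> H)) : Prop :=
  [/\ forall T, G T -> linear T /\ continuous T,
      G idfun,
      forall (c : R[i]) T1 T2, G T1 -> G T2 -> G (c *: T1 + T2)
    & forall T, G T ->
        exists2 T', G T' & forall x y, dot (T x) y = dot x (T' y)].

(* Matrices of operators, with the scalar action of R[i] (the library only
   provides an action of the type of entries, and only when it is a ring). *)
Definition opmx (R : realType) (H : lmodType R[i]) (n : nat) : Type :=
  'M[H -> H]_n.

Section OpmxLmodule.
Variables (R : realType) (H : lmodType R[i]) (n : nat).

HB.instance Definition _ := GRing.Zmodule.copy (opmx H n) 'M[H -> H]_n.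

Definition opmx_scale (c : R[i]) (g : opmx H n) : opmx H n :=
  map_mx (fun T : H -> H => c *: T) g.

Fact opmx_scaleA a b g : opmx_scale a (opmx_scale b g) = opmx_scale (a * b) g.
Proof. by apply/matrixP => i j; rewrite !mxE scalerA. Qed.

Fact opmx_scale1 : left_id 1 opmx_scale.
Proof. by move=> g; apply/matrixP => i j; rewrite !mxE scale1r. Qed.

Fact opmx_scaleDr : right_distributive opmx_scale +%R.
Proof. by move=> c g h; apply/matrixP => i j; rewrite !mxE scalerDr. Qed.

Fact opmx_scaleDl g : {morph opmx_scale^~ g : a b / a + b}.
Proof. by move=> a b; apply/matrixP => i j; rewrite !mxE scalerDl. Qed.

HB.instance Definition _ := GRing.Zmodule_isLmodule.Build R[i] (opmx H n)
  opmx_scaleA opmx_scale1 opmx_scaleDr opmx_scaleDl.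

End OpmxLmodule.

(* M_n(G), the operator matrices with entries in G *)
Definition mxset (R : realType) (H : lmodType R[i]) (G : set (H -> H))
    (n : nat) : set (opmx H n) :=
  [set g : 'M[H -> H]_n | forall i j, G (g i j)].
Arguments mxset {R H} G n.

(* the elementary tensor T (x) g *)
Definition tensop (R : realType) (H : lmodType R[i]) (n : nat)
    (T : 'M[R[i]]_n) (g : H -> H) : opmx H n :=
  map_mx (fun c : R[i] => c *: g) T.

Definition opdsum (R : realType) (H : lmodType R[i]) (m n : nat)
    (g' : opmx H m) (g'' : opmx H n) : opmx H (m + n) :=
  block_mx g' 0 0 g''.

Definition mxdsum (R : realType) (m n : nat)
    (A : 'M[R[i]]_m) (B : 'M[R[i]]_n) : 'M[R[i]]_(m + n) :=
  block_mx A 0 0 B.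

Definition Ad (R : realType) (n : nat) (S T : 'M[R[i]]_n) : 'M[R[i]]_n :=
  S *m T *m invmx S.

(* Ad S (x) I_G : linear extension of T (x) g |-> S T S^-1 (x) g, applied to
   g = \sum_(k, l) e_kl (x) g_kl *)
Definition AdI (R : realType) (H : lmodType R[i]) (n : nat)
    (S : 'M[R[i]]_n) (g : opmx H n) : opmx H n :=
  \sum_(k < n) \sum_(l < n)
    tensop (Ad S (delta_mx k l)) ((g : 'M[H -> H]_n) k l).

(* The norm of a matrix of operators is its norm as an operator on the Hilbert
   space direct sum of n copies of H. *)
Definition l2norm (R : realType) (H : normedModType R[i]) (n : nat)
    (x : 'I_n -> H) : R :=
  Num.sqrt (\sum_(i < n) nrm (x i) ^+ 2).

Definition opmx_apply (R : realType) (H : lmodType R[i]) (n : nat)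
    (g : opmx H n) (x : 'I_n -> H) : 'I_n -> H :=
  fun i => \sum_(j < n) (g : 'M[H -> H]_n) i j (x j).

Definition opnorm (R : realType) (H : normedModType R[i]) (n : nat)
    (g : opmx H n) : R :=
  sup [set l2norm (opmx_apply g x) | x in [set x | l2norm x <= 1]].

Definition opnorm2 (R : realType) (H : normedModType R[i]) (m n : nat)
    (g : opmx H m * opmx H n) : R :=
  Num.max (opnorm g.1) (opnorm g.2).

(* From here to analytic_on, E stands for a linear subspace of V on which N is
   a norm, and U for a subset of E. *)

Definition open_in (R : realType) (V : lmodType R[i]) (E : set V) (N : V -> R)
    (U : set V) : Prop :=
  forall a, U a -> exists2 rho : R, 0 < rho &
    forall x, E x -> N (x - a) < rho -> U x.

Definition subst_at (V : Type) (k : nat) (v : 'I_k -> V) (i : 'I_k) (x : V) :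
    'I_k -> V :=
  fun j => if j == i then x else v j.

Definition multilinear_on (R : realType) (V W : lmodType R[i]) (E : set V)
    (k : nat) (P : ('I_k -> V) -> W) : Prop :=
  forall (i : 'I_k) (v : 'I_k -> V) (c : R[i]) (x y : V),
    (forall j, E (v j)) -> E x -> E y ->
    P (subst_at v i (c *: x + y)) =
      c *: P (subst_at v i x) + P (subst_at v i y).

Definition bounded_on (R : realType) (V : lmodType R[i])
    (W : normedModType R[i]) (E : set V) (N : V -> R)
    (k : nat) (P : ('I_k -> V) -> W) : Prop :=
  exists M : R, forall v : 'I_k -> V, (forall j, E (v j)) ->
    nrm (P v) <= M * \prod_(j < k) N (v j).

(* f is analytic on U: around each point a of U it is the uniform sum, on a
   ball, of a power series \sum_k P_k(h, .., h) with P_k a bounded k-linear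
   map. Only the values of f on U matter, and P_k only matters on E. *)
Definition analytic_on (R : realType) (V : lmodType R[i])
    (W : normedModType R[i]) (E : set V) (N : V -> R) (U : set V)
    (f : V -> W) : Prop :=
  forall a, U a ->
  exists (rho : R) (P : forall k : nat, ('I_k -> V) -> W),
  [/\ 0 < rho,
      forall k, multilinear_on E (P k) /\ bounded_on E N (P k),
      forall h, E h -> N h < rho -> U (a + h)
    & forall e : R, 0 < e -> exists K0 : nat, forall K : nat, (K0 <= K)%N ->
        forall h, E h -> N h < rho ->
          nrm (f (a + h) - \sum_(k < K) P k (fun=> h)) < e].

Definition fully_matricial_set (R : realType) (H : lmodType R[i])
    (G : set (H -> H)) (Omega : forall n, set (opmx H n)) : Prop :=
  [/\ forall n, (0 < n)%N -> Omega n `<=` mxset G n,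
      forall m n, (0 < m)%N -> (0 < n)%N ->
        Omega (m + n)%N `&`
          [set opdsum g.1 g.2 | g in mxset G m `*` mxset G n] =
        [set opdsum g.1 g.2 | g in Omega m `*` Omega n]
    & forall n (S : 'M[R[i]]_n), (0 < n)%N -> S \in unitmx ->
        AdI S @` Omega n = Omega n].

Definition open_matricial (R : realType) (H : normedModType R[i])
    (G : set (H -> H)) (Omega : forall n, set (opmx H n)) : Prop :=
  forall n, (0 < n)%N ->
    open_in (mxset G n) (@opnorm R H n) (Omega n).

(* the set A(Omega) of scalar fully matricial analytic functions *)
Definition fm_analytic (R : realType) (H : normedModType R[i])
    (G : set (H -> H)) (Omega : forall n, set (opmx H n))
    (r : forall n, opmx H n -> 'M[R[i]]_n) : Prop :=
  [/\ forall n, (0 < n)%N ->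
        analytic_on (mxset G n) (@opnorm R H n) (Omega n) (r n),
      forall m n g' g'', (0 < m)%N -> (0 < n)%N ->
        Omega m g' -> Omega n g'' ->
        r (m + n)%N (opdsum g' g'') = mxdsum (r m g') (r n g'')
    & forall n (S : 'M[R[i]]_n) g, (0 < n)%N -> S \in unitmx ->
        Omega n g -> r n (AdI S g) = Ad S (r n g)].

(* The tensor product M_m (x) M_n is 'M_(m * n), with A (x) B = A *t B;
   tens_coef T i j k l is the coefficient of e_ij (x) e_kl in T. *)
Definition tens_coef (R : realType) (m n : nat) (T : 'M[R[i]]_(m * n))
    (i j : 'I_m) (k l : 'I_n) : R[i] :=
  T (mxtens_index (i, k)) (mxtens_index (j, l)).

(* phi (x) psi for linear maps phi and psi *)
Definition tens_map (R : realType) (m n m' n' : nat)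
    (phi : 'M[R[i]]_m -> 'M[R[i]]_m') (psi : 'M[R[i]]_n -> 'M[R[i]]_n')
    (T : 'M[R[i]]_(m * n)) : 'M[R[i]]_(m' * n') :=
  \sum_(i < m) \sum_(j < m) \sum_(k < n) \sum_(l < n)
    tens_coef T i j k l *: (phi (delta_mx i j) *t psi (delta_mx k l)).

(* X (+) Y in (M_m1 (+) M_m2) (x) M_n, contained in M_(m1 + m2) (x) M_n *)
Definition tens_dsuml (R : realType) (m1 m2 n : nat)
    (X : 'M[R[i]]_(m1 * n)) (Y : 'M[R[i]]_(m2 * n)) :
    'M[R[i]]_((m1 + m2) * n) :=
  tens_map (fun A : 'M_m1 => mxdsum A (0 : 'M_m2)) (@id 'M_n) X +
  tens_map (fun A : 'M_m2 => mxdsum (0 : 'M_m1) A) (@id 'M_n) Y.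

(* X (+) Y in M_m (x) (M_n1 (+) M_n2), contained in M_m (x) M_(n1 + n2) *)
Definition tens_dsumr (R : realType) (m n1 n2 : nat)
    (X : 'M[R[i]]_(m * n1)) (Y : 'M[R[i]]_(m * n2)) :
    'M[R[i]]_(m * (n1 + n2)) :=
  tens_map (@id 'M_m) (fun B : 'M_n1 => mxdsum B (0 : 'M_n2)) X +
  tens_map (@id 'M_m) (fun B : 'M_n2 => mxdsum (0 : 'M_n1) B) Y.

(* the set A(Omega; Omega) of two-variable functions *)
Definition fm_analytic2 (R : realType) (H : normedModType R[i])
    (G : set (H -> H)) (Omega : forall n, set (opmx H n))
    (f : forall m n, opmx H m -> opmx H n -> 'M[R[i]]_(m * n)) : Prop :=
  [/\ forall m n, (0 < m)%N -> (0 < n)%N ->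
        analytic_on (mxset G m `*` mxset G n) (@opnorm2 R H m n)
          (Omega m `*` Omega n) (fun g => f m n g.1 g.2),
      forall m n (S1 : 'M[R[i]]_m) (S2 : 'M[R[i]]_n) g1 g2,
        (0 < m)%N -> (0 < n)%N -> S1 \in unitmx -> S2 \in unitmx ->
        Omega m g1 -> Omega n g2 ->
        f m n (AdI S1 g1) (AdI S2 g2) =
          tens_map (Ad S1) (Ad S2) (f m n g1 g2),
      forall m1 m2 n g' g'' g,
        (0 < m1)%N -> (0 < m2)%N -> (0 < n)%N ->
        Omega m1 g' -> Omega m2 g'' -> Omega n g ->
        f (m1 + m2)%N n (opdsum g' g'') g =
          tens_dsuml (f m1 n g' g) (f m2 n g'' g)
    & forall m n1 n2 g g' g'',
        (0 < m)%N -> (0 < n1)%N -> (0 < n2)%N ->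
        Omega m g -> Omega n1 g' -> Omega n2 g'' ->
        f m (n1 + n2)%N g (opdsum g' g'') =
          tens_dsumr (f m n1 g g') (f m n2 g g'')].

(* lshift n i and rshift m l are the indices i and m + l of the matrices of
   size m + n. *)
Definition partial (R : realType) (H : normedModType R[i]) (m n : nat)
    (f : opmx H (m + n) -> 'M[R[i]]_(m + n))
    (g' : opmx H m) (g'' : opmx H n) : 'M[R[i]]_(m * n) :=
  \sum_(i < m) \sum_(j < m) \sum_(k < n) \sum_(l < n)
    derive1 (fun eps : R[i] =>
       f (opdsum g' g'' +
          eps *: tensop (delta_mx (lshift n j) (rshift m k)) idfun)) 0
      (lshift n i) (rshift m l)
    *: (delta_mx i j *t delta_mx k l).

(* Main.v *)
From HB Require Import structures.
Require Import Defs.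
From mathcomp Require Import all_boot all_order all_algebra.
From mathcomp Require Import sesquilinear complex mxtens.
From mathcomp Require Import boolp classical_sets functions reals.
From mathcomp Require Import interval_inference.
From mathcomp Require Import topology normedtype derive.
From mathcomp Require Import ring.

(* If g T = T h for a rectangular scalar matrix T and g, h in Omega, conjugating
   g (+) h by the unipotent block matrix [[1, T], [0, 1]] shows that
   r(g) T = T r(h). Together with openness and similarity invariance this gives,
   for every scalar matrix X,
     r [[g', X (x) 1], [0, g'']] = [[r(g'), D(X)], [0, r(g'')]],
   where D is linear in X and natural in (g', g'').  So the derivative defining
   partial is the difference quotient D(e_jk), with no limit involved: the
   algebraic identities are instances of naturality, and analyticity follows by
   expanding r itself around the point [[g', e_jk (x) 1], [0, g'']]. *)

Set Implicit Arguments.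
Unset Strict Implicit.
Unset Printing Implicit Defensive.

Import Order.TTheory GRing.Theory Num.Theory.
Import numFieldNormedType.Exports.
Local Open Scope ring_scope.
Local Open Scope complex_scope.

(** * Rectangular scalar matrices acting on matrices over a module *)

Section ScalarAction.
Variables (K : comNzRingType) (V : lmodType K).

(** The two matrix products in which one factor has entries in the module [V], where no
    multiplication is available. Rectangular scalar factors are allowed, so that inclusions and
    projections act as well as similarities. *)
Definition lactmx p m n (S : 'M[K]_(p, m)) (g : 'M[V]_(m, n)) : 'M[V]_(p, n) :=
  \matrix_(i, j) \sum_k S i k *: g k j.

Definition ractmx m n p (g : 'M[V]_(m, n)) (S : 'M[K]_(n, p)) : 'M[V]_(m, p) :=
  \matrix_(i, j) \sum_k S k j *: g i k.

Definition scalmx m n (v : V) (X : 'M[K]_(m, n)) : 'M[V]_(m, n) :=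
  map_mx (fun c => c *: v) X.

Definition intertwines m n (g1 : 'M[V]_m) (T : 'M[K]_(m, n)) (g2 : 'M[V]_n) :=
  ractmx g1 T = lactmx T g2.

Lemma ractmxA m n p q (g : 'M_(m, n)) (S : 'M_(n, p)) (T : 'M_(p, q)) :
  ractmx (ractmx g S) T = ractmx g (S *m T).
Proof.
apply/matrixP => i j; rewrite !mxE.
under [RHS]eq_bigr do rewrite mxE scaler_suml.
rewrite exchange_big; apply: eq_bigr => k _; rewrite mxE scaler_sumr.
by apply: eq_bigr => l _; rewrite scalerA mulrC.
Qed.

Lemma lact1mx m n (g : 'M_(m, n)) : lactmx 1%:M g = g.
Proof.
apply/matrixP => i j; rewrite mxE (bigD1 i) //= big1 => [|k /negPf ki].
  by rewrite mxE eqxx scale1r addr0.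
by rewrite mxE eq_sym ki scale0r.
Qed.

Lemma ractmx1 m n (g : 'M_(m, n)) : ractmx g 1%:M = g.
Proof.
apply/matrixP => i j; rewrite mxE (bigD1 j) //= big1 => [|k /negPf kj].
  by rewrite mxE eqxx scale1r addr0.
by rewrite mxE kj scale0r.
Qed.

Lemma lact0mx p m n (g : 'M_(m, n)) : lactmx (0 : 'M_(p, m)) g = 0.
Proof. by apply/matrixP => i j; rewrite !mxE big1 // => k; rewrite mxE scale0r. Qed.

Lemma lactmx0 p m n (S : 'M_(p, m)) : lactmx S (0 : 'M_(m, n)) = 0.
Proof. by apply/matrixP => i j; rewrite !mxE big1 // => k; rewrite mxE scaler0. Qed.

Lemma ractmx0 p m n (g : 'M_(m, n)) : ractmx g (0 : 'M_(n, p)) = 0.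
Proof. by apply/matrixP => i j; rewrite !mxE big1 // => k; rewrite mxE scale0r. Qed.

Lemma ract0mx p m n (S : 'M_(n, p)) : ractmx (0 : 'M_(m, n)) S = 0.
Proof. by apply/matrixP => i j; rewrite !mxE big1 // => k; rewrite mxE scaler0. Qed.

Lemma lactmxZl p m n c (S : 'M_(p, m)) (g : 'M_(m, n)) :
  lactmx (c *: S) g = map_mx ( *:%R c) (lactmx S g).
Proof.
apply/matrixP => i j; rewrite !mxE scaler_sumr.
by apply: eq_bigr => k _; rewrite mxE scalerA.
Qed.

Lemma ractmxZr p m n c (S : 'M_(n, p)) (g : 'M_(m, n)) :
  ractmx g (c *: S) = map_mx ( *:%R c) (ractmx g S).
Proof.
apply/matrixP => i j; rewrite !mxE scaler_sumr.
by apply: eq_bigr => k _; rewrite mxE scalerA.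
Qed.

Lemma lact_row_col p m1 m2 n (S1 : 'M_(p, m1)) (S2 : 'M_(p, m2))
    (g1 : 'M_(m1, n)) (g2 : 'M_(m2, n)) :
  lactmx (row_mx S1 S2) (col_mx g1 g2) = lactmx S1 g1 + lactmx S2 g2.
Proof.
apply/matrixP => i j; rewrite !mxE big_split_ord; congr +%R;
by apply: eq_bigr => k _; rewrite ?row_mxEl ?row_mxEr ?col_mxEu ?col_mxEd.
Qed.

Lemma ract_row_col p m1 m2 n (S1 : 'M_(m1, n)) (S2 : 'M_(m2, n))
    (g1 : 'M_(p, m1)) (g2 : 'M_(p, m2)) :
  ractmx (row_mx g1 g2) (col_mx S1 S2) = ractmx g1 S1 + ractmx g2 S2.
Proof.
apply/matrixP => i j; rewrite !mxE big_split_ord; congr +%R;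
by apply: eq_bigr => k _; rewrite ?row_mxEl ?row_mxEr ?col_mxEu ?col_mxEd.
Qed.

Lemma lact_col p1 p2 m n (S1 : 'M_(p1, m)) (S2 : 'M_(p2, m)) (g : 'M_(m, n)) :
  lactmx (col_mx S1 S2) g = col_mx (lactmx S1 g) (lactmx S2 g).
Proof.
apply/matrixP => i j; case: (split_ordP i) => k ->;
by rewrite ?col_mxEu ?col_mxEd !mxE; apply: eq_bigr => l _;
  rewrite ?col_mxEu ?col_mxEd.
Qed.

Lemma lact_row p m n1 n2 (S : 'M_(p, m)) (g1 : 'M_(m, n1)) (g2 : 'M_(m, n2)) :
  lactmx S (row_mx g1 g2) = row_mx (lactmx S g1) (lactmx S g2).
Proof.
apply/matrixP => i j; case: (split_ordP j) => k ->;
by rewrite ?row_mxEl ?row_mxEr !mxE; apply: eq_bigr => l _;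
  rewrite ?row_mxEl ?row_mxEr.
Qed.

Lemma ract_col m n1 n2 p (g1 : 'M_(n1, m)) (g2 : 'M_(n2, m)) (S : 'M_(m, p)) :
  ractmx (col_mx g1 g2) S = col_mx (ractmx g1 S) (ractmx g2 S).
Proof.
apply/matrixP => i j; case: (split_ordP i) => k ->;
by rewrite ?col_mxEu ?col_mxEd !mxE; apply: eq_bigr => l _;
  rewrite ?col_mxEu ?col_mxEd.
Qed.

Lemma ract_row m n p1 p2 (g : 'M_(m, n)) (S1 : 'M_(n, p1)) (S2 : 'M_(n, p2)) :
  ractmx g (row_mx S1 S2) = row_mx (ractmx g S1) (ractmx g S2).
Proof.
apply/matrixP => i j; case: (split_ordP j) => k ->;
by rewrite ?row_mxEl ?row_mxEr !mxE; apply: eq_bigr => l _;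
  rewrite ?row_mxEl ?row_mxEr.
Qed.

Lemma lact_scalmx p m n (S : 'M_(p, m)) (v : V) (X : 'M_(m, n)) :
  lactmx S (scalmx v X) = scalmx v (S *m X).
Proof.
apply/matrixP => i j; rewrite !mxE scaler_suml.
by apply: eq_bigr => k _; rewrite mxE scalerA.
Qed.

Lemma ract_scalmx m n p (v : V) (X : 'M_(m, n)) (S : 'M_(n, p)) :
  ractmx (scalmx v X) S = scalmx v (X *m S).
Proof.
apply/matrixP => i j; rewrite !mxE scaler_suml.
by apply: eq_bigr => k _; rewrite mxE scalerA mulrC.
Qed.

(** The upper right blocks of the two products are [scalmx v (X1 *m Q)] and [scalmx v (P *m X)]: a
    block of the form X (x) v lets scalars pass through, so a purely scalar equation suffices. *)
Lemma intertwines_block_diag m1 n1 m n (g1' : 'M_m1) (g1'' : 'M_n1) (v : V)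
    (X1 : 'M_(m1, n1)) (g' : 'M_m) (g'' : 'M_n) (X : 'M_(m, n))
    (P : 'M_(m1, m)) (Q : 'M_(n1, n)) :
  intertwines g1' P g' -> intertwines g1'' Q g'' -> X1 *m Q = P *m X ->
  intertwines (block_mx g1' (scalmx v X1) 0 g1'') (block_mx P 0 0 Q)
    (block_mx g' (scalmx v X) 0 g'').
Proof.
rewrite /intertwines => hP hQ hX.
rewrite /block_mx ract_col lact_col !ract_row_col !lact_row_col.
rewrite !(ract_row, lact_row, lact0mx, ract0mx, ractmx0, lactmx0).
rewrite hP hQ ract_scalmx lact_scalmx hX row_mx0 !add_row_mx.
by rewrite !(addr0, add0r).
Qed.

(** An upper triangular matrix leaves the first coordinate block invariant, and the inclusion of
    that block intertwines. The next three lemmas are the analogous inclusion and projections; with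
    [Y] equal to 0 they concern direct sums. *)
Lemma intertwines_col10 m n (g' : 'M_m) (g'' : 'M_n) (Y : 'M_(m, n)) :
  intertwines (block_mx g' Y 0 g'') (col_mx 1%:M 0) g'.
Proof.
rewrite /intertwines /block_mx ract_col !ract_row_col lact_col.
by rewrite !ractmx0 ractmx1 ract0mx lact1mx lact0mx !addr0.
Qed.

Lemma intertwines_row01 m n (g' : 'M_m) (g'' : 'M_n) (Y : 'M_(m, n)) :
  intertwines g'' (row_mx 0 1%:M) (block_mx g' Y 0 g'').
Proof.
rewrite /intertwines /block_mx ract_row lact_row_col.
by rewrite ractmx0 ractmx1 lact0mx lact1mx add0r.
Qed.

Lemma intertwines_row10 m n (g' : 'M_m) (g'' : 'M_n) (Y : 'M_(n, m)) :
  intertwines g' (row_mx 1%:M 0) (block_mx g' 0 Y g'').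
Proof.
rewrite /intertwines /block_mx ract_row lact_row_col.
by rewrite ractmx0 ractmx1 lact0mx lact1mx addr0.
Qed.

Lemma intertwines_col01 m n (g' : 'M_m) (g'' : 'M_n) (Y : 'M_(n, m)) :
  intertwines (block_mx g' 0 Y g'') (col_mx 0 1%:M) g''.
Proof.
rewrite /intertwines /block_mx ract_col !ract_row_col lact_col.
by rewrite !ractmx0 !ractmx1 lact1mx lact0mx !add0r.
Qed.

(** The diagonal embedding; it is the source of the additivity of [corner]. *)
Lemma intertwines_col11 n (g : 'M_n) :
  intertwines (block_mx g 0 0 g) (col_mx 1%:M 1%:M) g.
Proof.
rewrite /intertwines /block_mx ract_col !ract_row_col lact_col.
by rewrite !ractmx1 lact1mx addr0 add0r.
Qed.

Lemma intertwines_scalar n c (g : 'M_n) : intertwines g c%:M g.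
Proof.
by rewrite /intertwines -scalemx1 lactmxZl ractmxZr lact1mx ractmx1.
Qed.

(** The upper right blocks of the two products are g1 T and T g2. This turns a rectangular
    intertwiner into an invertible one, to which similarity equivariance applies. *)
Lemma intertwines_unipotent m n (g1 : 'M_m) (T : 'M_(m, n)) (g2 : 'M_n) :
  intertwines g1 T g2 ->
  intertwines (block_mx g1 0 0 g2) (block_mx 1%:M T 0 1%:M)
    (block_mx g1 0 0 g2).
Proof.
rewrite /intertwines => hT.
rewrite /block_mx ract_col lact_col !ract_row_col !lact_row_col.
rewrite !(ract_row, lact_row, lact0mx, ract0mx, ractmx0, lactmx0).
by rewrite hT !lact1mx !ractmx1 !add_row_mx !addr0 !add0r.
Qed.

End ScalarAction.

(** * Real-valued norms on modules over [R[i]] and on finite direct sums *)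

Section Norms.
Variable R : realType.
Implicit Types W H : normedModType R[i].

Lemma nrmE W (w : W) : `|w| = (nrm w)%:C.
Proof. by rewrite /nrm RRe_real // ger0_real. Qed.

Lemma nrm_ge0 W (w : W) : 0 <= nrm w.
Proof. by rewrite -ler0c -nrmE. Qed.

Lemma nrmD W (v w : W) : nrm (v + w) <= nrm v + nrm w.
Proof. by rewrite -lecR rmorphD /= -!nrmE ler_normD. Qed.

Lemma nrmZ W (c : R[i]) (w : W) : nrm (c *: w) = complex.Re `|c| * nrm w.
Proof.
have cE : `|c| = (complex.Re `|c|)%:C by rewrite RRe_real ?ger0_real.
by rewrite {1}/nrm normrZ nrmE cE -rmorphM.
Qed.

Lemma nrm0 W : nrm (0 : W) = 0.
Proof. by rewrite /nrm normr0. Qed.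

Lemma nrm_sum W I (s : seq I) (F : I -> W) :
  nrm (\sum_(i <- s) F i) <= \sum_(i <- s) nrm (F i).
Proof.
elim/big_rec2: _ => [|i y w _ le_wy]; first by rewrite nrm0.
by apply: le_trans (nrmD _ _) _; rewrite lerD2l.
Qed.

Lemma nrm_mx_entry m n (A : 'M[R[i]]_(m, n)) i j :
  complex.Re `|A i j| <= nrm A.
Proof.
rewrite -lecR -nrmE RRe_real ?ger0_real //.
rewrite [leRHS]/Num.norm /= mx_normE -[leLHS]nngE num_le.
exact: (le_bigmax _ (fun ij : 'I_m * 'I_n => `|A ij.1 ij.2|%:nng) (i, j)).
Qed.

Lemma l2norm_ge0 H n (x : 'I_n -> H) : 0 <= l2norm x.
Proof. exact: sqrtr_ge0. Qed.

Lemma l2norm_sqr H n (x : 'I_n -> H) : l2norm x ^+ 2 = \sum_i nrm (x i) ^+ 2.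
Proof. by rewrite sqr_sqrtr // sumr_ge0 // => i _; rewrite sqr_ge0. Qed.

Lemma nrm_le_l2norm H n (x : 'I_n -> H) i : nrm (x i) <= l2norm x.
Proof.
rewrite -(ler_pXn2r (ltn0Sn 1)) ?nnegrE ?nrm_ge0 ?l2norm_ge0 // l2norm_sqr.
by rewrite (bigD1 i) //= lerDl sumr_ge0 // => j _; rewrite sqr_ge0.
Qed.

Lemma l2norm_le_sum H n (x : 'I_n -> H) : l2norm x <= \sum_i nrm (x i).
Proof.
have s0 : 0 <= \sum_i nrm (x i) by apply: sumr_ge0 => i _; exact: nrm_ge0.
rewrite -(ler_pXn2r (ltn0Sn 1)) ?nnegrE ?l2norm_ge0 // l2norm_sqr expr2.
rewrite mulr_sumr ler_sum // => i _; rewrite expr2 ler_wpM2r ?nrm_ge0 //.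
by rewrite (bigD1 i) //= lerDl sumr_ge0 // => j _; exact: nrm_ge0.
Qed.

Lemma l2norm0 H n : l2norm (fun _ : 'I_n => 0 : H) = 0 :> R.
Proof. by rewrite /l2norm big1 ?sqrtr0 // => i _; rewrite nrm0 expr0n. Qed.

Lemma l2normZ H n c (x : 'I_n -> H) :
  l2norm (fun i => c *: x i) = complex.Re `|c| * l2norm x.
Proof.
have c0 : 0 <= complex.Re `|c| by rewrite -ler0c RRe_real ?ger0_real.
rewrite /l2norm -[in RHS](ger0_norm c0) -sqrtr_sqr -sqrtrM ?sqr_ge0 //.
by rewrite mulr_sumr; congr Num.sqrt; apply: eq_bigr => i _; rewrite nrmZ exprMn.
Qed.

Lemma l2norm_split_sqr H m n (x : 'I_(m + n) -> H) :
  l2norm x ^+ 2 = l2norm (x \o @lshift m n) ^+ 2 + l2norm (x \o @rshift m n) ^+ 2.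
Proof. by rewrite !l2norm_sqr big_split_ord. Qed.

Lemma l2norm_lshift_le H m n (x : 'I_(m + n) -> H) :
  l2norm (x \o @lshift m n) <= l2norm x.
Proof.
rewrite -(ler_pXn2r (ltn0Sn 1)) ?nnegrE ?l2norm_ge0 //.
by rewrite [leRHS]l2norm_split_sqr lerDl sqr_ge0.
Qed.

Lemma l2norm_rshift_le H m n (x : 'I_(m + n) -> H) :
  l2norm (x \o @rshift m n) <= l2norm x.
Proof.
rewrite -(ler_pXn2r (ltn0Sn 1)) ?nnegrE ?l2norm_ge0 //.
by rewrite [leRHS]l2norm_split_sqr lerDr sqr_ge0.
Qed.

Lemma l2norm_split_le H m n (x : 'I_(m + n) -> H) :
  l2norm x <= l2norm (x \o @lshift m n) + l2norm (x \o @rshift m n).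
Proof.
rewrite -(ler_pXn2r (ltn0Sn 1)) ?nnegrE ?addr_ge0 ?l2norm_ge0 //.
by rewrite l2norm_split_sqr sqrrD lerD2r lerDl mulrn_wge0 // mulr_ge0 ?l2norm_ge0.
Qed.

(** Continuous linear maps are bounded; the work is to pass from a bound in [R[i]] to one in [R]. *)
Lemma continuous_linear_nrm_le W H (T : W -> H) :
  linear T -> continuous T ->
  exists2 M : R, 0 <= M & forall x, nrm (T x) <= M * nrm x.
Proof.
move=> linT ctsT.
pose LT := GRing.isLinear.Build R[i] W H *:%R T linT.
pose f : {linear W -> H} := HB.pack T LT.
have /linear_bounded_continuous/linear_boundedP fbd : continuous f by [].
have [M M0] : exists2 M : R[i], 0 <= M & forall x, `|T x| <= M * `|x|.
  near (pinfty_nbhs R[i]) => M; exists M; last by near: M.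
  by near: M; exact: nbhs_pinfty_ge.
(* In the order of [R[i]], a number above 0 is real, so nothing is lost by taking the real part. *)
have ME : M = (complex.Re M)%:C by rewrite RRe_real // ger0_real.
exists (complex.Re M); first by rewrite -ler0c -ME.
by move=> x; rewrite -lecR rmorphM /= -ME -!nrmE.
Unshelve. all: by end_near.
Qed.

(** * The operator norm on matrices over an operator system *)

Section OperatorNorm.
Variables (H : normedModType R[i]) (G : set (H -> H)).
Hypothesis hG : forall T, G T -> linear T /\ continuous T.

(** Finitely many entries, each a bounded operator. This makes the supremum in [opnorm] that of a
    bounded set, without which [opnorm g] would not dominate the values. *)
Lemma opmx_apply_bounded n (g : opmx H n) : mxset G n g ->
  exists M : R, forall x, l2norm x <= 1 -> l2norm (opmx_apply g x) <= M.
Proof.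
move=> Gg.
have /choice[M MP] : forall ij : 'I_n * 'I_n, exists M : R, 0 <= M /\
    forall x, nrm ((g : 'M[H -> H]_n) ij.1 ij.2 x) <= M * nrm x.
  move=> [i j]; have [lT cT] := hG (Gg i j).
  by have [M M0 MP] := continuous_linear_nrm_le lT cT; exists M.
exists (\sum_i \sum_j M (i, j)) => x x1; apply: le_trans (l2norm_le_sum _) _.
apply: ler_sum => i _; apply: le_trans (nrm_sum _ _) _.
apply: ler_sum => j _; have [M0 /(_ (x j)) /= le_M] := MP (i, j).
apply: le_trans le_M _; rewrite -[leRHS]mulr1 ler_wpM2l //.
exact: le_trans (nrm_le_l2norm _ _) x1.
Qed.

Lemma opnorm_le n (g : opmx H n) (M : R) :
  (forall x, l2norm x <= 1 -> l2norm (opmx_apply g x) <= M) -> opnorm g <= M.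
Proof.
move=> gM; apply: ge_sup; last by move=> _ [x /= /gM xM <-].
(* The zero vector lies in the unit ball, so the supremum is over a nonempty set. *)
by exists (l2norm (opmx_apply g (fun=> 0))), (fun=> 0); rewrite //= l2norm0 ler01.
Qed.

Lemma le_opnorm n (g : opmx H n) x :
  mxset G n g -> l2norm x <= 1 -> l2norm (opmx_apply g x) <= opnorm g.
Proof.
move=> /opmx_apply_bounded[M gM] x1; apply: ub_le_sup; last by exists x.
by exists M => _ [y /= /gM yM <-].
Qed.

Lemma opnorm_ge0 n (g : opmx H n) : mxset G n g -> 0 <= opnorm g.
Proof.
move=> Gg; apply: le_trans (l2norm_ge0 _) (@le_opnorm _ g (fun=> 0) Gg _).
by rewrite l2norm0 ler01.
Qed.

Lemma opnormZ_le n c (g : opmx H n) :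
  mxset G n g -> opnorm (c *: g) <= complex.Re `|c| * opnorm g.
Proof.
move=> Gg; apply: opnorm_le => x x1.
have -> : opmx_apply (c *: g) x = fun i => c *: opmx_apply g x i.
  apply/funext => i; rewrite /opmx_apply scaler_sumr.
  by apply: eq_bigr => j _; rewrite mxE.
rewrite l2normZ ler_wpM2l ?le_opnorm //.
by rewrite -ler0c RRe_real ?ger0_real.
Qed.

(** Each diagonal block sees only its own part of [x], which still lies in the unit ball. The sum,
    cruder than the maximum, is enough for continuity of the direct sum map. *)
Lemma opnorm_opdsum_le m n (g' : opmx H m) (g'' : opmx H n) :
  mxset G m g' -> mxset G n g'' ->
  opnorm (opdsum g' g'') <= opnorm g' + opnorm g''.
Proof.
move=> Gg' Gg''; apply: opnorm_le => x x1.
apply: le_trans (l2norm_split_le _) _.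
have -> : opmx_apply (opdsum g' g'') x \o @lshift m n =
    opmx_apply g' (x \o @lshift m n).
  apply/funext => i /=; rewrite /opmx_apply big_split_ord /= [X in _ + X]big1.
    by rewrite addr0; apply: eq_bigr => j _; rewrite block_mxEul.
  by move=> j _; rewrite block_mxEur mxE.
have -> : opmx_apply (opdsum g' g'') x \o @rshift m n =
    opmx_apply g'' (x \o @rshift m n).
  apply/funext => i /=; rewrite /opmx_apply big_split_ord /= [X in X + _]big1.
    by rewrite add0r; apply: eq_bigr => j _; rewrite block_mxEdr.
  by move=> j _; rewrite block_mxEdl mxE.
by apply: lerD; apply: le_opnorm => //; apply: le_trans x1;
  rewrite (l2norm_lshift_le, l2norm_rshift_le).
Qed.

End OperatorNorm.
End Norms.

(** * Closure properties of analytic functions *)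

Section AnalyticOn.
Variables (R : realType) (V : lmodType R[i]) (E : set V) (N : V -> R).
Implicit Types W : normedModType R[i].

Lemma eq_analytic_on W U (f g : V -> W) :
  (forall a, U a -> f a = g a) -> analytic_on E N U f -> analytic_on E N U g.
Proof.
move=> fg fU a Ua; have [rho [P [rho0 PP Urho Pf]]] := fU a Ua.
exists rho, P; split=> // e /Pf[K0 PK0]; exists K0 => K K0K h Eh hrho.
by rewrite -fg ?PK0 //; exact: Urho.
Qed.

Variable U : set V.
Hypothesis openU : forall a, U a -> exists2 rho : R, 0 < rho &
  forall h, E h -> N h < rho -> U (a + h).

(** Even for the zero function a ball inside [U] has to be exhibited, which is where openness
    enters. *)
Lemma analytic_on0 W : analytic_on E N U (fun=> 0 : W).
Proof.
move=> a /openU[rho rho0 Urho]; exists rho, (fun _ _ => 0); split=> // [k|e e0].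
  split=> [i v c x y _ _ _|]; first by rewrite scaler0 addr0.
  by exists 0 => v _; rewrite nrm0 mul0r.
by exists 0%N => K _ h _ _; rewrite big1 // subr0 nrm0.
Qed.

Lemma analytic_onD W (f g : V -> W) :
  analytic_on E N U f -> analytic_on E N U g ->
  analytic_on E N U (fun v => f v + g v).
Proof.
move=> fU gU a Ua.
have [rho1 [P [rho10 PP Urho1 Pf]]] := fU a Ua.
have [rho2 [Q [rho20 QQ Urho2 Qg]]] := gU a Ua.
exists (Num.min rho1 rho2), (fun k v => P k v + Q k v); split.
- by rewrite lt_min rho10.
- move=> k; have [linP [M PM]] := PP k; have [linQ [L QL]] := QQ k.
  split=> [i v c x y Ev Ex Ey|].
    by rewrite linP // linQ // scalerDr addrACA.
  exists (M + L) => v Ev; apply: le_trans (nrmD _ _) _.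
  by rewrite mulrDl lerD ?PM ?QL.
- by move=> h Eh; rewrite lt_min => /andP[/Urho1 + _]; exact.
- move=> e e0; have e2 : 0 < e / 2 by rewrite divr_gt0.
  have [K1 PK1] := Pf _ e2; have [K2 QK2] := Qg _ e2.
  exists (maxn K1 K2) => K; rewrite geq_max => /andP[K1K K2K] h Eh.
  rewrite lt_min => /andP[h1 h2]; rewrite big_split /= opprD addrACA.
  rewrite (splitr e).
  by apply: le_lt_trans (nrmD _ _) (ltrD (PK1 _ _ _ _ _) (QK2 _ _ _ _ _)).
Qed.

Lemma analytic_on_sum W I (s : seq I) (f : I -> V -> W) :
  (forall i, analytic_on E N U (f i)) ->
  analytic_on E N U (fun v => \sum_(i <- s) f i v).
Proof.
move=> fU; elim: s => [|i s IHs].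
  by apply: eq_analytic_on (analytic_on0 W) => a _; rewrite big_nil.
apply: eq_analytic_on (analytic_onD (fU i) IHs) => a _.
by rewrite big_cons.
Qed.

(** The translation [b] only moves the centre of expansion, so the terms are [L] after [P k] after
    [lam]. The radius shrinks by the factor [C], and the bound of the term of degree k grows by
    [D * C ^+ k]. *)
Lemma analytic_on_comp_affine (V' : lmodType R[i]) (E' : set V') (N' : V' -> R)
    (U' : set V') W W' (f : V' -> W) (b : V') (lam : {linear V -> V'})
    (L : {linear W -> W'}) (C D : R) :
  0 < C -> 0 < D ->
  (forall h, E h -> E' (lam h)) -> (forall h, E' h -> 0 <= N' h) ->
  (forall h, E h -> N' (lam h) <= C * N h) ->
  (forall w, nrm (L w) <= D * nrm w) ->
  (forall a, U a -> U' (b + lam a)) ->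
  analytic_on E' N' U' f -> analytic_on E N U (fun v => L (f (b + lam v))).
Proof.
move=> C0 D0 EE' N'0 NN' LD UU' fU' a Ua.
have [rho' [P [rho'0 PP U'rho Pf]]] := fU' _ (UU' a Ua).
have [rho rho0 Urho] := openU Ua.
have lam_lt h : E h -> N h < rho' / C -> N' (lam h) < rho'.
  move=> Eh hrho; apply: le_lt_trans (NN' h Eh) _.
  by rewrite mulrC -ltr_pdivlMr.
exists (Num.min rho (rho' / C)), (fun k v => L (P k (lam \o v))); split.
- by rewrite lt_min rho0 divr_gt0.
- move=> k; have [linP [M PM]] := PP k.
  have substE (v : 'I_k -> V) i x :
      lam \o subst_at v i x = subst_at (lam \o v) i (lam x).
    by apply/funext => j; rewrite /= /subst_at; case: ifP.
  split=> [i v c x y Ev Ex Ey|].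
    rewrite !substE linearP linP; [by rewrite linearP| |exact: EE'|exact: EE'].
    by move=> j; exact: EE'.
  (* The absolute value is taken because the sign of [M] is unknown, while a nonnegative factor is
     needed to enlarge the product of norms. *)
  exists (D * (`|M| * C ^+ k)) => v Ev; apply: le_trans (LD _) _.
  rewrite -mulrA ler_wpM2l ?(ltW D0) //.
  have EE'v j : E' (lam (v j)) by exact: EE'.
  apply: le_trans (PM (lam \o v) EE'v) _.
  apply: (@le_trans _ _ (`|M| * \prod_j N' (lam (v j)))).
    by rewrite ler_wpM2r ?ler_norm // prodr_ge0 // => j _; exact: N'0 (EE'v j).
  rewrite -mulrA ler_wpM2l //.
  have -> : C ^+ k * \prod_j N (v j) = \prod_j (C * N (v j)).
    by rewrite big_split /= prodr_const card_ord.
  by apply: ler_prod => j _; rewrite N'0 ?NN'.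
- by move=> h Eh; rewrite lt_min => /andP[/Urho + _]; exact.
- move=> e e0; have [K0 PK0] := Pf (e / D) (divr_gt0 e0 D0).
  exists K0 => K K0K h Eh; rewrite lt_min => /andP[_ /(lam_lt h Eh) hrho].
  rewrite -linear_sum -linearB (linearD lam) addrA.
  apply: le_lt_trans (LD _) _.
  by rewrite mulrC -ltr_pdivlMr // PK0 //; exact: EE'.
Qed.

End AnalyticOn.

(** * Coefficients of elements of a tensor product of matrix algebras *)

Section TensorCoefficients.
Variable R : realType.

Lemma tens_coef_inj m n (A B : 'M[R[i]]_(m * n)) :
  (forall i j k l, tens_coef A i j k l = tens_coef B i j k l) -> A = B.
Proof.
move=> AB; apply/matrixP => x y.
by case: (mxtens_indexP x) => i k; case: (mxtens_indexP y) => j l; exact: AB.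
Qed.

Lemma linear_mx_sum m n (W : lmodType R[i]) (f : 'M[R[i]]_(m, n) -> W) A :
  linear f -> f A = \sum_i \sum_j A i j *: f (delta_mx i j).
Proof.
move=> linf; pose Lf := GRing.isLinear.Build R[i] 'M[R[i]]_(m, n) W *:%R f linf.
pose g : {linear 'M[R[i]]_(m, n) -> W} := HB.pack f Lf.
rewrite [A in LHS]matrix_sum_delta -[f _]/(g _) linear_sum.
apply: eq_bigr => i _; rewrite linear_sum.
by apply: eq_bigr => j _; rewrite linearZ.
Qed.

(** The tensor product of maps is computed one factor at a time: [phi] for each fixed pair (k', l'),
    then [psi] on the scalar matrix so obtained. Expanding both over matrix units leaves only
    exchanges of finite sums. *)
Lemma tens_map_coef m n m' n' (phi : 'M[R[i]]_m -> 'M_m')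
    (psi : 'M[R[i]]_n -> 'M_n') (T : 'M_(m * n)) i j k l :
  linear phi -> linear psi ->
  tens_coef (tens_map phi psi T) i j k l =
  psi (\matrix_(k', l')
    phi (\matrix_(i', j') tens_coef T i' j' k' l') i j) k l.
Proof.
move=> linphi linpsi; rewrite (linear_mx_sum _ linpsi) summxE.
under [RHS]eq_bigr => k' _ do rewrite summxE.
under [RHS]eq_bigr => k' _ do under eq_bigr => l' _ do
  rewrite 2!mxE (linear_mx_sum _ linphi) summxE mulr_suml.
under [RHS]eq_bigr => k' _ do rewrite exchange_big.
rewrite [RHS]exchange_big /tens_coef summxE; apply: eq_bigr => i' _.
under [RHS]eq_bigr => k' _ do under eq_bigr => l' _ do
  rewrite summxE mulr_suml.
under [RHS]eq_bigr => k' _ do rewrite exchange_big.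
rewrite [RHS]exchange_big summxE; apply: eq_bigr => j' _.
rewrite summxE; apply: eq_bigr => k' _; rewrite summxE; apply: eq_bigr => l' _.
by rewrite [LHS]mxE tensmxE 2!mxE mulrA.
Qed.

(** The sum is [tens_map id id T] for the tensor [T] with coefficients [c], so the previous formula
    applies with two identity maps. It is used to read off the coefficients of [partial]. *)
Lemma sum_tens_coef m n (c : 'I_m -> 'I_m -> 'I_n -> 'I_n -> R[i]) i j k l :
  tens_coef (\sum_i' \sum_j' \sum_k' \sum_l'
    c i' j' k' l' *: (delta_mx i' j' *t delta_mx k' l')) i j k l = c i j k l.
Proof.
pose T : 'M[R[i]]_(m * n) := \matrix_(x, y)
  c (mxtens_unindex x).1 (mxtens_unindex y).1
    (mxtens_unindex x).2 (mxtens_unindex y).2.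
have TE i' j' k' l' : tens_coef T i' j' k' l' = c i' j' k' l'.
  by rewrite /tens_coef mxE !mxtens_indexK.
have := @tens_map_coef _ _ _ _ id id T i j k l (fun _ _ _ => erefl)
  (fun _ _ _ => erefl).
rewrite 2!mxE TE => <-; congr tens_coef.
by do 4![apply: eq_bigr => ? _]; rewrite TE.
Qed.

Lemma mxdsuml_linear m1 m2 : linear (fun A : 'M[R[i]]_m1 => mxdsum A (0 : 'M_m2)).
Proof.
by move=> c A B; rewrite /mxdsum scale_block_mx add_block_mx !scaler0 !addr0.
Qed.

Lemma mxdsumr_linear m1 m2 : linear (fun A : 'M[R[i]]_m2 => mxdsum (0 : 'M_m1) A).
Proof.
by move=> c A B; rewrite /mxdsum scale_block_mx add_block_mx !scaler0 !addr0.
Qed.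

Lemma mxdsumD m n (A : 'M[R[i]]_m) (B : 'M_n) :
  mxdsum A 0 + mxdsum 0 B = mxdsum A B.
Proof. by rewrite /mxdsum add_block_mx !addr0 add0r. Qed.

Lemma id_mx_linear n : linear (@id 'M[R[i]]_n).
Proof. by []. Qed.

(** The second factor undergoes the identity, so for fixed k and l this is an ordinary direct sum in
    the indices i, j. *)
Lemma tens_dsuml_coef m1 m2 n (X : 'M[R[i]]_(m1 * n)) (Y : 'M_(m2 * n)) i j k l :
  tens_coef (tens_dsuml X Y) i j k l =
  mxdsum (\matrix_(i', j') tens_coef X i' j' k l)
    (\matrix_(i', j') tens_coef Y i' j' k l) i j.
Proof.
rewrite -mxdsumD [RHS]mxE.
have := tens_map_coef X i j k l (@mxdsuml_linear m1 m2) (@id_mx_linear n).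
have := tens_map_coef Y i j k l (@mxdsumr_linear m1 m2) (@id_mx_linear n).
by rewrite [X in _ = X -> _]mxE [X in _ -> _ = X -> _]mxE => <- <-;
  rewrite /tens_coef mxE.
Qed.

Lemma tens_dsumr_coef m n1 n2 (X : 'M[R[i]]_(m * n1)) (Y : 'M_(m * n2)) i j k l :
  tens_coef (tens_dsumr X Y) i j k l =
  mxdsum (\matrix_(k', l') tens_coef X i j k' l')
    (\matrix_(k', l') tens_coef Y i j k' l') k l.
Proof.
have idE p (Z : 'M[R[i]]_(m * p)) :
    \matrix_(k', l') (\matrix_(i', j') tens_coef Z i' j' k' l') i j =
    \matrix_(k', l') tens_coef Z i j k' l'.
  by apply/matrixP => x y; rewrite !mxE.
rewrite -mxdsumD [RHS]mxE.
have := tens_map_coef X i j k l (@id_mx_linear m) (@mxdsuml_linear n1 n2).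
have := tens_map_coef Y i j k l (@id_mx_linear m) (@mxdsumr_linear n1 n2).
by rewrite !idE => <- <-; rewrite /tens_coef mxE.
Qed.

Lemma Ad_linear n (S : 'M[R[i]]_n) : linear (Ad S).
Proof. by move=> c A B; rewrite /Ad mulmxDr mulmxDl -scalemxAr -scalemxAl. Qed.

End TensorCoefficients.

(** * Similarities and intertwiners on a fully matricial set *)

Section FullyMatricial.
Variables (R : realType) (H : completeNormedModType R[i]).
Implicit Types (m n p : nat).

(** Both entries at (i, j) are sums over k, l of [g k l] with coefficient [S i k * invmx S l j],
    since only one term survives in each product with a matrix unit. *)
Lemma AdIE n (S : 'M[R[i]]_n) (g : opmx H n) :
  AdI S g = ractmx (lactmx S (g : 'M[H -> H]_n)) (invmx S).
Proof.
apply/matrixP => i j; rewrite summxE mxE.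
under [RHS]eq_bigr do rewrite mxE scaler_sumr.
rewrite [RHS]exchange_big; apply: eq_bigr => k _; rewrite summxE.
apply: eq_bigr => l _; rewrite mxE scalerA; congr (_ *: _).
rewrite /Ad mxE (bigD1 l) //= big1 => [|q /negPf ql].
  rewrite addr0 mulrC; congr (_ * _); rewrite mxE (bigD1 k) //= big1.
    by rewrite mxE !eqxx mulr1 addr0.
  by move=> q /negPf qk; rewrite mxE qk mulr0.
by rewrite mxE big1 ?mul0r // => t _; rewrite mxE ql andbF mulr0.
Qed.

(** Similarity stated without an inverse, so that it can be checked block by block. *)
Lemma AdI_intertwines n (S : 'M[R[i]]_n) (g1 g2 : 'M[H -> H]_n) :
  S \in unitmx -> intertwines g1 S g2 -> AdI S (g2 : opmx H n) = g1.
Proof. by move=> uS h; rewrite AdIE -h ractmxA mulmxV // ractmx1. Qed.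

Lemma intertwines_AdI n (S : 'M[R[i]]_n) (g : 'M[H -> H]_n) :
  S \in unitmx -> intertwines (AdI S (g : opmx H n)) S g.
Proof. by move=> uS; rewrite /intertwines AdIE ractmxA mulVmx // ractmx1. Qed.

Variables (dot : {dot H for (@Num.conj R[i])}) (G : set (H -> H)).
Variable Omega : forall n, set (opmx H n).
Variable r : forall n, opmx H n -> 'M[R[i]]_n.
Hypothesis hG : operator_system dot G.
Hypothesis hOmega : fully_matricial_set G Omega.
Hypothesis hopen : open_matricial G Omega.
Hypothesis hr : fm_analytic G Omega r.

Lemma Omega_opdsum m n (g' : opmx H m) (g'' : opmx H n) :
  (0 < m)%N -> (0 < n)%N -> Omega g' -> Omega g'' -> Omega (opdsum g' g'').
Proof.
have [_ Osum _] := hOmega => m0 n0 O1 O2.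
have : [set opdsum g.1 g.2 | g in @Omega m `*` @Omega n]%classic (opdsum g' g'').
  by exists (g', g'').
by rewrite -Osum // => -[].
Qed.

Lemma fm_intertwines m n (g1 : opmx H m) (g2 : opmx H n) (T : 'M_(m, n)) :
  (0 < m)%N -> (0 < n)%N -> Omega g1 -> Omega g2 ->
  intertwines (g1 : 'M[H -> H]_m) T g2 -> r g1 *m T = T *m r g2.
Proof.
move=> m0 n0 O1 O2 hT; have [_ hsum hAd] := hr.
have uS : block_mx 1%:M T 0 1%:M \in @unitmx R[i] (m + n).
  by rewrite unitmxE det_ublock !det1 mulr1 unitr1.
have O12 := Omega_opdsum m0 n0 O1 O2.
have := hAd _ _ _ _ uS O12; rewrite addn_gt0 m0 => /(_ isT).
rewrite (AdI_intertwines uS (intertwines_unipotent hT)) hsum // => hE.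
(* Multiplying on the right by the unipotent matrix clears the inverse in [Ad]; the upper right
   block of the resulting equation is the claim. *)
have := congr1 (mulmx^~ (block_mx 1%:M T 0 1%:M)) hE.
rewrite /Ad mulmxKV // /mxdsum !mulmx_block => /eq_block_mx[_ + _ _].
by rewrite !(mulmx1, mul1mx, mul0mx, mulmx0, addr0, add0r).
Qed.

Let hGlin T : G T -> linear T /\ continuous T.
Proof. by have [+ _ _ _] := hG; exact. Qed.

Let G0 : G 0.
Proof.
have [_ G1 GZD _] := hG.
by rewrite -(addNr (idfun : H -> H)) -scaleN1r; exact: GZD.
Qed.

Let GZ c T : G T -> G (c *: T).
Proof. by have [_ _ GZD _] := hG; move=> GT; rewrite -[_ *: _]addr0; exact: GZD. Qed.

Lemma mxset_opdsum m n (g' : opmx H m) (g'' : opmx H n) :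
  mxset G m g' -> mxset G n g'' -> mxset G (m + n) (opdsum g' g'').
Proof.
move=> Gg' Gg'' i j.
by case: (split_ordP i) => k ->; case: (split_ordP j) => l ->;
  rewrite ?block_mxEul ?block_mxEur ?block_mxEdl ?block_mxEdr ?mxE //.
Qed.

Lemma mxset_tensop n (T : 'M_n) : mxset G n (tensop T idfun).
Proof. by have [_ G1 _ _] := hG; move=> i j; rewrite mxE; exact: GZ. Qed.

(** * Block upper triangular points with a scalar corner *)

Definition optri m n (g' : opmx H m) (g'' : opmx H n) (X : 'M[R[i]]_(m, n)) :
    opmx H (m + n) :=
  block_mx (g' : 'M[H -> H]_m) (scalmx idfun X) 0 (g'' : 'M[H -> H]_n).

Lemma optriE m n (g' : opmx H m) (g'' : opmx H n) X :
  optri g' g'' X = opdsum g' g'' + tensop (block_mx 0 X 0 0) idfun.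
Proof.
apply/matrixP => i j; rewrite [RHS]mxE [X in _ + X]mxE.
by case: (split_ordP i) => k ->; case: (split_ordP j) => l ->;
  rewrite ?block_mxEul ?block_mxEur ?block_mxEdl ?block_mxEdr ?mxE
    ?scale0r ?addr0 ?add0r.
Qed.

Lemma tensopZ n c (T : 'M[R[i]]_n) (v : H -> H) :
  tensop (c *: T) v = c *: tensop T v.
Proof. by apply/matrixP => i j; rewrite !mxE scalerA. Qed.

Lemma Omega_mxset n (g : opmx H n) : (0 < n)%N -> Omega g -> mxset G n g.
Proof. by have [h _ _] := hOmega; move=> n0 /(h _ n0). Qed.

Lemma Omega_AdI n (S : 'M_n) (g : opmx H n) :
  (0 < n)%N -> S \in unitmx -> Omega g -> Omega (AdI S g).
Proof.
by have [_ _ hS] := hOmega => n0 uS Og; rewrite -(hS _ _ n0 uS); exists g.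
Qed.

(** Openness gives the claim for a small multiple of [X], and a diagonal similarity rescales the
    corner to [X] itself. *)
Lemma Omega_optri m n (g' : opmx H m) (g'' : opmx H n) X :
  (0 < m)%N -> (0 < n)%N -> Omega g' -> Omega g'' -> Omega (optri g' g'' X).
Proof.
move=> m0 n0 O1 O2; have mn0 : (0 < m + n)%N by rewrite addn_gt0 m0.
have O12 := Omega_opdsum m0 n0 O1 O2.
have [rho rho0 Orho] := hopen mn0 O12.
set Y := tensop (block_mx 0 X 0 0 : 'M_(m + n)) (idfun : H -> H).
have GY : mxset G (m + n) Y by exact: mxset_tensop.
have oY := opnorm_ge0 hGlin GY.
(* Chosen so that [e * opnorm Y < rho]; the added 1 keeps the denominator positive when the norm of
   [Y] is 0. *)
pose e : R := rho / (opnorm Y + 1).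
have e0 : 0 < e by rewrite divr_gt0 // ltr_wpDl.
have eN0 : e%:C != 0.
  by rewrite -(rmorph0 (real_complex R)) (inj_eq (@complexI _)) gt_eqF.
have Oe : Omega (optri g' g'' (e%:C *: X)).
  apply: Orho.
    rewrite optriE => i j; rewrite mxE.
    have [_ _ GZD _] := hG; rewrite -[X in G (X + _)]scale1r; apply: GZD.
      by apply: mxset_opdsum; exact: Omega_mxset.
    exact: mxset_tensop.
  have -> : optri g' g'' (e%:C *: X) - opdsum g' g'' = e%:C *: Y.
    rewrite optriE [X in X - _]addrC addrK -tensopZ; congr tensop.
    by rewrite scale_block_mx !scaler0.
  apply: le_lt_trans (opnormZ_le hGlin _ GY) _.
  rewrite ger0_norm ?ler0c ?(ltW e0) //= -mulrA gtr_pMr // mulrC.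
  by rewrite ltr_pdivrMr ?mul1r ?ltrDl ?ltr01 // ltr_wpDl.
(* Conjugation by this matrix fixes the diagonal blocks and multiplies the upper right one by the
   inverse of [e]. *)
pose S := block_mx (e%:C^-1)%:M 0 0 1%:M : 'M[R[i]]_(m + n).
have uS : S \in unitmx.
  rewrite unitmxE det_ublock det_scalar det1 mulr1 unitfE expf_neq0 //.
  by rewrite invr_eq0.
have <- : AdI S (optri g' g'' (e%:C *: X)) = optri g' g'' X.
  apply: (AdI_intertwines uS); apply: intertwines_block_diag.
  - exact: intertwines_scalar.
  - exact: intertwines_scalar.
  - by rewrite mulmx1 mul_scalar_mx scalerA mulVf // scale1r.
exact: Omega_AdI.
Qed.

(** * The corner map, which is [D] in the overview: naturality and linearity *)

Definition corner m n (g' : opmx H m) (g'' : opmx H n) (X : 'M[R[i]]_(m, n)) :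
    'M[R[i]]_(m, n) :=
  ursubmx (r (optri g' g'' X)).

(** The inclusion of the first block fixes the first block column of the value of [r], and the
    projection onto the second block fixes its last block row. *)
Lemma fm_optri m n (g' : opmx H m) (g'' : opmx H n) X :
  (0 < m)%N -> (0 < n)%N -> Omega g' -> Omega g'' ->
  r (optri g' g'' X) = block_mx (r g') (corner g' g'' X) 0 (r g'').
Proof.
move=> m0 n0 O1 O2; have mn0 : (0 < m + n)%N by rewrite addn_gt0 m0.
have Ot := Omega_optri X m0 n0 O1 O2.
have := fm_intertwines mn0 m0 Ot O1 (intertwines_col10 g' g'' (scalmx idfun X)).
have := fm_intertwines n0 mn0 O2 Ot (intertwines_row01 g' g'' (scalmx idfun X)).
rewrite -[r (optri _ _ _)]submxK -/(corner _ _ _).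
rewrite mul_mx_row mul_row_block mul_block_col mul_col_mx.
rewrite !(mulmx0, mul0mx, mulmx1, mul1mx, addr0, add0r).
by move=> /eq_row_mx[<- <-] /eq_col_mx[<- _].
Qed.

(** The block diagonal matrix of [P] and [Q] intertwines the two triangular points; the claim is the
    upper right block of the relation this forces on [r]. *)
Lemma corner_natural m1 n1 m n (g1' : opmx H m1) (g1'' : opmx H n1)
    (X1 : 'M_(m1, n1)) (g' : opmx H m) (g'' : opmx H n) (X : 'M_(m, n))
    (P : 'M_(m1, m)) (Q : 'M_(n1, n)) :
  (0 < m1)%N -> (0 < n1)%N -> (0 < m)%N -> (0 < n)%N ->
  Omega g1' -> Omega g1'' -> Omega g' -> Omega g'' ->
  intertwines (g1' : 'M[H -> H]_m1) P g' ->
  intertwines (g1'' : 'M[H -> H]_n1) Q g'' -> X1 *m Q = P *m X ->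
  corner g1' g1'' X1 *m Q = P *m corner g' g'' X.
Proof.
move=> m10 n10 m0 n0 O1' O1'' O' O'' hP hQ hX.
have := fm_intertwines _ _ (Omega_optri X1 m10 n10 O1' O1'')
  (Omega_optri X m0 n0 O' O'') (intertwines_block_diag idfun hP hQ hX).
rewrite !addn_gt0 m10 m0 => /(_ isT isT).
rewrite !fm_optri // !mulmx_block => /eq_block_mx[_ + _ _].
by rewrite !(mulmx0, mul0mx, addr0, add0r).
Qed.

(** Naturality along the projections of the direct sum onto its summands, with the identity on [g],
    isolates each block row. *)
Lemma corner_opdsuml m1 m2 n (g' : opmx H m1) (g'' : opmx H m2) (g : opmx H n)
    X1 X2 :
  (0 < m1)%N -> (0 < m2)%N -> (0 < n)%N ->
  Omega g' -> Omega g'' -> Omega g ->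
  corner (opdsum g' g'') g (col_mx X1 X2) =
    col_mx (corner g' g X1) (corner g'' g X2).
Proof.
move=> m10 m20 n0 O' O'' O; have Os := Omega_opdsum m10 m20 O' O''.
have ms0 : (0 < m1 + m2)%N by rewrite addn_gt0 m10.
rewrite -[LHS]vsubmxK; congr col_mx.
  rewrite -[RHS]mulmx1
    (corner_natural (X := col_mx X1 X2) (P := row_mx 1%:M 0)
      m10 n0 ms0 n0 O' O Os O).
  - by rewrite -[X in _ *m X]vsubmxK mul_row_col mul1mx mul0mx addr0.
  - exact: intertwines_row10.
  - exact: intertwines_scalar.
  - by rewrite mulmx1 mul_row_col mul1mx mul0mx addr0.
rewrite -[RHS]mulmx1
    (corner_natural (X := col_mx X1 X2) (P := row_mx 0 1%:M)
      m20 n0 ms0 n0 O'' O Os O).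
- by rewrite -[X in _ *m X]vsubmxK mul_row_col mul1mx mul0mx add0r.
- exact: intertwines_row01.
- exact: intertwines_scalar.
- by rewrite mulmx1 mul_row_col mul1mx mul0mx add0r.
Qed.

(** Here the inclusions of the summands isolate each block column. *)
Lemma corner_opdsumr m n1 n2 (g : opmx H m) (g' : opmx H n1) (g'' : opmx H n2)
    X1 X2 :
  (0 < m)%N -> (0 < n1)%N -> (0 < n2)%N ->
  Omega g -> Omega g' -> Omega g'' ->
  corner g (opdsum g' g'') (row_mx X1 X2) =
    row_mx (corner g g' X1) (corner g g'' X2).
Proof.
move=> m0 n10 n20 O O' O''; have Os := Omega_opdsum n10 n20 O' O''.
have ns0 : (0 < n1 + n2)%N by rewrite addn_gt0 n10.
rewrite -[LHS]hsubmxK; congr row_mx.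
  rewrite -[RHS]mul1mx
    -(corner_natural (X1 := row_mx X1 X2) (Q := col_mx 1%:M 0)
      m0 ns0 m0 n10 O Os O O').
  - by rewrite -[X in X *m _]hsubmxK mul_row_col mulmx1 mulmx0 addr0.
  - exact: intertwines_scalar.
  - exact: intertwines_col10.
  - by rewrite mul1mx mul_row_col mulmx1 mulmx0 addr0.
rewrite -[RHS]mul1mx
    -(corner_natural (X1 := row_mx X1 X2) (Q := col_mx 0 1%:M)
      m0 ns0 m0 n20 O Os O O'').
- by rewrite -[X in X *m _]hsubmxK mul_row_col mulmx1 mulmx0 add0r.
- exact: intertwines_scalar.
- exact: intertwines_col01.
- by rewrite mul1mx mul_row_col mulmx1 mulmx0 add0r.
Qed.

(** Homogeneity is naturality along the scalar intertwiner [c%:M]. Additivity comes from doubling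
    [g'']: the diagonal embedding sends the row of [c *: X] and [Y] to their sum. *)
Lemma corner_linear m n (g' : opmx H m) (g'' : opmx H n) :
  (0 < m)%N -> (0 < n)%N -> Omega g' -> Omega g'' -> linear (corner g' g'').
Proof.
move=> m0 n0 O1 O2 c X Y.
have cornerZ : corner g' g'' (c *: X) = c *: corner g' g'' X.
  rewrite -[LHS]mulmx1 -[RHS]mul_scalar_mx; apply: corner_natural => //;
    try exact: intertwines_scalar.
  by rewrite mulmx1 mul_scalar_mx.
have O22 := Omega_opdsum n0 n0 O2 O2.
rewrite -cornerZ -[LHS]mul1mx -(@corner_natural m (n + n) m n g' (opdsum g'' g'')
  (row_mx (c *: X) Y) g' g'' _ _ (col_mx 1%:M 1%:M)) //.
- by rewrite corner_opdsumr // mul_row_col !mulmx1.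
- by rewrite addn_gt0 n0.
- exact: intertwines_scalar.
- exact: intertwines_col11.
- by rewrite mul1mx mul_row_col !mulmx1.
Qed.

Lemma corner0 m n (g' : opmx H m) (g'' : opmx H n) :
  (0 < m)%N -> (0 < n)%N -> Omega g' -> Omega g'' -> corner g' g'' 0 = 0.
Proof.
move=> m0 n0 O1 O2; have := corner_linear m0 n0 O1 O2 (-1) 0 0.
by rewrite scaler0 scaleN1r addr0 addNr.
Qed.

(** * The derivative in [partial] as a value of the corner map *)

Lemma delta_mx_ur m n (j : 'I_m) (k : 'I_n) :
  delta_mx (lshift n j) (rshift m k) =
    block_mx 0 (delta_mx j k) 0 0 :> 'M[R[i]]_(m + n).
Proof.
apply/matrixP => x y; case: (split_ordP x) => x' ->;
  case: (split_ordP y) => y' ->;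
  rewrite ?block_mxEul ?block_mxEur ?block_mxEdl ?block_mxEdr !mxE
  ?eq_lrshift ?eq_rlshift ?andbF //=.
by rewrite (inj_eq (@lshift_inj _ _)) (inj_eq (@rshift_inj _ _)).
Qed.

Lemma derive1_corner m n (g' : opmx H m) (g'' : opmx H n) i j k l :
  (0 < m)%N -> (0 < n)%N -> Omega g' -> Omega g'' ->
  derive1 (fun eps : R[i] => r (opdsum g' g'' +
      eps *: tensop (delta_mx (lshift n j) (rshift m k)) idfun)) 0
      (lshift n i) (rshift m l) =
  corner g' g'' (delta_mx j k) i l.
Proof.
move=> m0 n0 O1 O2; set F := fun eps : R[i] => _.
pose M : 'M[R[i]]_(m + n) := block_mx 0 (corner g' g'' (delta_mx j k)) 0 0.
(* By linearity of the corner, [F] is affine on the whole line, all of whose points give elements of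
   [Omega]. *)
have FE e : F e = F 0 + e *: M.
  have FE' a : F a =
      block_mx (r g') (a *: corner g' g'' (delta_mx j k)) 0 (r g'').
    have -> : a *: corner g' g'' (delta_mx j k) =
        corner g' g'' (a *: delta_mx j k).
      have := corner_linear m0 n0 O1 O2 a (delta_mx j k) 0.
      by rewrite corner0 // !addr0.
    rewrite -fm_optri // optriE /F -tensopZ delta_mx_ur.
    by rewrite scale_block_mx !scaler0.
  rewrite !FE' scale0r /M scale_block_mx add_block_mx.
  by rewrite !(scaler0, addr0, add0r).
(* The difference quotient equals [M] at every nonzero [h], so its limit is that of a constant. *)
have -> : derive1 F 0 = M.
  apply: lim_near_cst => //; near=> h.
  have h0 : h != 0 by near: h; exact: nbhs_dnbhs_neq.
  by rewrite addr0 FE [F 0 + _]addrC addrK scalerA mulVf // scale1r.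
by rewrite /M block_mxEur.
Unshelve. all: by end_near.
Qed.

(** * Coefficients of [partial], equivariance and direct sums *)

Lemma partial_coef m n (g' : opmx H m) (g'' : opmx H n) i j k l :
  (0 < m)%N -> (0 < n)%N -> Omega g' -> Omega g'' ->
  tens_coef (partial (@r (m + n)) g' g'') i j k l =
  corner g' g'' (delta_mx j k) i l.
Proof.
by move=> m0 n0 O1 O2; rewrite /partial sum_tens_coef derive1_corner.
Qed.

Lemma partial_AdI m n (S1 : 'M_m) (S2 : 'M_n) (g1 : opmx H m) (g2 : opmx H n) :
  (0 < m)%N -> (0 < n)%N -> S1 \in unitmx -> S2 \in unitmx ->
  Omega g1 -> Omega g2 ->
  partial (@r (m + n)) (AdI S1 g1) (AdI S2 g2) =
    tens_map (Ad S1) (Ad S2) (partial (@r (m + n)) g1 g2).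
Proof.
move=> m0 n0 u1 u2 O1 O2; apply: tens_coef_inj => i j k l.
have OA1 := Omega_AdI m0 u1 O1; have OA2 := Omega_AdI n0 u2 O2.
rewrite partial_coef // tens_map_coef; [|exact: Ad_linear|exact: Ad_linear].
(* [D] names the coefficients as an opaque function, so that entrywise expansion stops there. *)
have [D DE] : exists D, forall i' j' k' l',
    corner g1 g2 (delta_mx j' k') i' l' = D i' j' k' l' by eexists.
have -> : (\matrix_(k', l') Ad S1 (\matrix_(i', j')
      tens_coef (partial (@r (m + n)) g1 g2) i' j' k' l') i j) =
    \matrix_(k', l') Ad S1 (\matrix_(i', j') D i' j' k' l') i j.
  apply/matrixP => k' l'; rewrite [LHS]mxE [RHS]mxE; congr (Ad _ _ _ _).
  by apply/matrixP => i' j'; rewrite [LHS]mxE [RHS]mxE partial_coef.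
(* Naturality along [S1] and [S2]; the argument on the right is the [X] solving S1 X = e_jk S2. *)
have cE : corner (AdI S1 g1) (AdI S2 g2) (delta_mx j k) =
    S1 *m corner g1 g2 (invmx S1 *m delta_mx j k *m S2) *m invmx S2.
  rewrite -(corner_natural (X1 := delta_mx j k) (Q := S2) m0 n0 m0 n0 OA1 OA2).
  - by rewrite mulmxK.
  - by [].
  - by [].
  - exact: intertwines_AdI.
  - exact: intertwines_AdI.
  - by rewrite mulmxA mulmxA mulmxV // mul1mx.
(* The argument has rank one: column j of the inverse of [S1] times row k of [S2]. *)
have dE j' k' : (invmx S1 *m delta_mx j k *m S2) j' k' = invmx S1 j' j * S2 k k'.
  rewrite mxE (bigD1 k) //= big1 => [|x /negPf xk]; last first.
    by rewrite mxE big1 ?mul0r // => y _; rewrite mxE xk andbF mulr0.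
  rewrite addr0 mxE (bigD1 j) //= big1 => [|y /negPf yj]; last first.
    by rewrite mxE yj mulr0.
  by rewrite mxE !eqxx mulr1 addr0.
rewrite cE (linear_mx_sum _ (corner_linear m0 n0 O1 O2)) /Ad !mxE.
apply: eq_bigr => l' _; congr (_ * _); rewrite !mxE.
(* Expanded over matrix units, [S1] and its inverse act on i', j', while [S2] and its inverse act on
   k', l', as the tensor product of the two similarities requires. *)
transitivity (\sum_i' \sum_j' \sum_k'
    S1 i i' * (invmx S1 j' j * S2 k k' * D i' j' k' l')).
  apply: eq_bigr => i' _; rewrite summxE mulr_sumr; apply: eq_bigr => j' _.
  by rewrite summxE mulr_sumr; apply: eq_bigr => k' _; rewrite mxE dE DE.
under eq_bigr => i' _ do rewrite exchange_big.
rewrite exchange_big; apply: eq_bigr => k' _.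
rewrite exchange_big !mxE mulr_sumr; apply: eq_bigr => j' _.
rewrite !mxE mulr_suml mulr_sumr; apply: eq_bigr => i' _.
by rewrite mxE; ring.
Qed.

(** The direction e_jk meets only the block row containing j. The corner of the other summand is
    then evaluated at 0 and vanishes, so a coefficient survives only when i and j lie in the same
    block. *)
Lemma partial_opdsuml m1 m2 n (g' : opmx H m1) (g'' : opmx H m2) (g : opmx H n) :
  (0 < m1)%N -> (0 < m2)%N -> (0 < n)%N ->
  Omega g' -> Omega g'' -> Omega g ->
  partial (@r (m1 + m2 + n)) (opdsum g' g'') g =
    tens_dsuml (partial (@r (m1 + n)) g' g) (partial (@r (m2 + n)) g'' g).
Proof.
move=> m10 m20 n0 O' O'' O; have Os := Omega_opdsum m10 m20 O' O''.
apply: tens_coef_inj => i j k l.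
rewrite partial_coef ?addn_gt0 ?m10 // tens_dsuml_coef /mxdsum.
case: (split_ordP j) => j' ->.
  have -> : delta_mx (lshift m2 j') k = col_mx (delta_mx j' k) 0 :> 'M[R[i]]_(_, n).
    apply/matrixP => x y; case: (split_ordP x) => x' ->;
    by rewrite ?col_mxEu ?col_mxEd !mxE ?(inj_eq (@lshift_inj _ _)) ?eq_rlshift.
  rewrite corner_opdsuml // (@corner0 _ _ g'') //; case: (split_ordP i) => i' ->.
    by rewrite col_mxEu block_mxEul mxE partial_coef.
  by rewrite col_mxEd block_mxEdl !mxE.
have -> : delta_mx (rshift m1 j') k = col_mx 0 (delta_mx j' k) :> 'M[R[i]]_(_, n).
  apply/matrixP => x y; case: (split_ordP x) => x' ->;
  by rewrite ?col_mxEu ?col_mxEd !mxE ?(inj_eq (@rshift_inj _ _)) ?eq_lrshift.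
rewrite corner_opdsuml // (@corner0 _ _ g') //; case: (split_ordP i) => i' ->.
  by rewrite col_mxEu block_mxEur !mxE.
by rewrite col_mxEd block_mxEdr mxE partial_coef.
Qed.

(** The same argument by columns, with k and l in place of i and j. *)
Lemma partial_opdsumr m n1 n2 (g : opmx H m) (g' : opmx H n1) (g'' : opmx H n2) :
  (0 < m)%N -> (0 < n1)%N -> (0 < n2)%N ->
  Omega g -> Omega g' -> Omega g'' ->
  partial (@r (m + (n1 + n2))) g (opdsum g' g'') =
    tens_dsumr (partial (@r (m + n1)) g g') (partial (@r (m + n2)) g g'').
Proof.
move=> m0 n10 n20 O O' O''; have Os := Omega_opdsum n10 n20 O' O''.
apply: tens_coef_inj => i j k l.
rewrite partial_coef ?addn_gt0 ?n10 // tens_dsumr_coef /mxdsum.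
case: (split_ordP k) => k' ->.
  have -> : delta_mx j (lshift n2 k') = row_mx (delta_mx j k') 0 :> 'M[R[i]]_(m, _).
    apply/matrixP => x y; case: (split_ordP y) => y' ->;
    by rewrite ?row_mxEl ?row_mxEr !mxE ?(inj_eq (@lshift_inj _ _)) ?eq_rlshift ?andbF.
  rewrite corner_opdsumr // (@corner0 _ _ g g'') //; case: (split_ordP l) => l' ->.
    by rewrite row_mxEl block_mxEul mxE partial_coef.
  by rewrite row_mxEr block_mxEur !mxE.
have -> : delta_mx j (rshift n1 k') = row_mx 0 (delta_mx j k') :> 'M[R[i]]_(m, _).
  apply/matrixP => x y; case: (split_ordP y) => y' ->;
  by rewrite ?row_mxEl ?row_mxEr !mxE ?(inj_eq (@rshift_inj _ _)) ?eq_lrshift ?andbF.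
rewrite corner_opdsumr // (@corner0 _ _ g g') //; case: (split_ordP l) => l' ->.
  by rewrite row_mxEl block_mxEdl !mxE.
by rewrite row_mxEr block_mxEdr mxE partial_coef.
Qed.

(** * Analyticity of [partial] *)

Lemma partial_analytic m n : (0 < m)%N -> (0 < n)%N ->
  analytic_on (mxset G m `*` mxset G n)%classic (@opnorm2 R H m n)
    (@Omega m `*` @Omega n)%classic
    (fun g => partial (@r (m + n)) g.1 g.2).
Proof.
move=> m0 n0; have mn0 : (0 < m + n)%N by rewrite addn_gt0 m0.
have [ran _ _] := hr.
set E := (_ `*` _)%classic; set U := (_ `*` _)%classic.
(* Openness of the product restated with increments; that [a + h] has entries in [G] follows from
   closure of [G] under addition. *)
have openU a : U a -> exists2 rho : R, 0 < rho &
    forall h, E h -> opnorm2 h < rho -> U (a + h).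
  move=> [/= O1 O2].
  have [rho1 rho10 Orho1] := hopen m0 O1; have [rho2 rho20 Orho2] := hopen n0 O2.
  have [_ _ GZD _] := hG.
  have GD p (g h : opmx H p) : mxset G p g -> mxset G p h -> mxset G p (g + h).
    move=> Gg Gh x y; rewrite mxE -[X in G (X + _)]scale1r.
    exact: GZD (Gg x y) (Gh x y).
  exists (Num.min rho1 rho2); first by rewrite lt_min rho10.
  move=> h [/= E1 E2]; rewrite /opnorm2 gt_max !lt_min.
  move=> /andP[/andP[h1 _] /andP[_ h2]].
  split=> /=.
    apply: Orho1; first by apply: GD => //; exact: Omega_mxset.
    by rewrite addrC addKr.
  apply: Orho2; first by apply: GD => //; exact: Omega_mxset.
  by rewrite addrC addKr.
pose lam0 (g : opmx H m * opmx H n) := opdsum g.1 g.2.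
have linlam : linear lam0.
  move=> c g h; apply/matrixP => x y; rewrite [RHS]mxE [X in _ = X + _]mxE.
  by case: (split_ordP x) => x' ->; case: (split_ordP y) => y' ->;
    rewrite ?block_mxEul ?block_mxEur ?block_mxEdl ?block_mxEdr !mxE
      ?scaler0 ?addr0.
pose Llam := GRing.isLinear.Build R[i] (opmx H m * opmx H n)%type
  (opmx H (m + n)) *:%R lam0 linlam.
pose lam : {linear (opmx H m * opmx H n)%type -> opmx H (m + n)} :=
  HB.pack lam0 Llam.
pose t i j k l (A : 'M[R[i]]_(m + n)) : 'M[R[i]]_(m * n) :=
  A (lshift n i) (rshift m l) *: (delta_mx i j *t delta_mx k l).
pose b j k : opmx H (m + n) :=
  tensop (delta_mx (lshift n j) (rshift m k)) (idfun : H -> H).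
have bE j k g' g'' : b j k + opdsum g' g'' = optri g' g'' (delta_mx j k).
  by rewrite optriE /b delta_mx_ur addrC.
(* On pairs from [Omega] each derivative is an entry of [r] at a triangular point, which depends on
   the pair through an affine map. Hence [partial] is a finite sum of maps that are linear after [r]
   after affine. *)
apply: (@eq_analytic_on _ _ _ _ _ _ (fun g => \sum_i \sum_j \sum_k \sum_l
    t i j k l (r (b j k + lam g)))).
  move=> g [O1 O2]; rewrite /partial.
  do 4![apply: eq_bigr => ? _]; rewrite derive1_corner // /t bE.
  by rewrite /corner !mxE.
do 4![apply: analytic_on_sum => // ?].
set i := (X in t X); set j := (X in t _ X); set k := (X in t _ _ X).
set l := (X in t _ _ _ X).
have lint : linear (t i j k l).
  by move=> c A B; rewrite /t !mxE scalerDl scalerA.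
pose Lt := GRing.isLinear.Build R[i] 'M[R[i]]_(m + n) 'M[R[i]]_(m * n) *:%R
  (t i j k l) lint.
pose L : {linear 'M[R[i]]_(m + n) -> 'M[R[i]]_(m * n)} := HB.pack (t i j k l) Lt.
(* The added 1 makes the constant strictly positive. *)
pose D := nrm (delta_mx i j *t delta_mx k l : 'M[R[i]]_(m * n)) + 1.
(* The constant 2 arises because the norm of a direct sum was bounded by a sum, and each term is at
   most the maximum [opnorm2]. *)
apply: (@analytic_on_comp_affine R _ E (@opnorm2 R H m n) U openU _
  (mxset G (m + n)) (@opnorm R H (m + n)) (@Omega (m + n)) _ _ (@r (m + n))
  (b j k) lam L 2 D).
- by [].
- by rewrite ltr_wpDl ?nrm_ge0.
- by move=> h [E1 E2]; exact: mxset_opdsum.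
- exact: opnorm_ge0.
- move=> h [E1 E2]; apply: le_trans (opnorm_opdsum_le hGlin E1 E2) _.
  by rewrite mulr_natl mulr2n lerD // /opnorm2 le_max lexx ?orbT.
- move=> w; rewrite /L /= /t nrmZ mulrC ler_pM ?nrm_ge0 //.
  + by rewrite -ler0c RRe_real ?ger0_real.
  + by rewrite lerDl.
  + exact: nrm_mx_entry.
- by move=> a [O1 O2]; rewrite bE; exact: Omega_optri.
- exact: ran.
Qed.

End FullyMatricial.

Theorem lemma7p12 (R : realType) (H : completeNormedModType R[i])
    (dot : {dot H for (@Num.conj R[i])}) (hdot : hilbert_dot dot)
    (G : set (H -> H)) (hG : operator_system dot G)
    (Omega : forall n, set (opmx H n))
    (hOmega : fully_matricial_set G Omega)
    (hopen : open_matricial G Omega)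
    (r : forall n, opmx H n -> 'M[R[i]]_n)
    (hr : fm_analytic G Omega r) :
  fm_analytic2 G Omega
    (fun m n g' g'' => partial (r (m + n)%N) g' g'').
Proof.
split.
- by move=> m n m0 n0; exact: partial_analytic hG hOmega hopen hr _ _ m0 n0.
- by move=> *; exact: (partial_AdI hG hOmega hopen hr).
- by move=> *; exact: (partial_opdsuml hG hOmega hopen hr).
- by move=> *; exact: (partial_opdsumr hG hOmega hopen hr).
Qed.
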